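(* Let $\xi$ be a real random variable with symmetric (hence centered) law satisfying, for all large $t$, $\mathbb P\{|\xi|>t\}\asymp t^{-4}(\log t)^{-2}$ (two-sided bounds up to positive constants). Then $\mathbb E|\xi|^4<\infty$. For each $n$ let $\Xi_n=(\xi^{(n)}_{ij})_{i,j\le n}$ have $n^2$ i.i.d. entries distributed as $\xi$, let the rows of the triangular array (i.e. the matrices $\Xi_n$ for different $n$) be mutually independent, and let $X_n=n^{-1/2}\Xi_n$. Then for every fixed $c>0$, $$\mathbb P\Big\{\max_{i,j\le n}|\xi^{(n)}_{ij}|>c\sqrt n\Big\}\asymp(\log n)^{-2}\quad\text{for large }n,$$ so these probabilities tend to zero but are not summable; almost surely, $\max_{i,j\le n}|\xi^{(n)}_{ij}|>c\sqrt n$ (hence $\|X_n\|>c$) for infinitely many $n$. In particular, almost-sure convergence of the operator norm $\|X_n\|$ to the edge value fails for this independently resampled triangular array, so at the finite-fourth-moment threshold there is no almost-sure strong convergence theorem for triangular arrays valid for every coupling of the different rows.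
   Context: $\|\cdot\|$ is the operator norm. $f(n)\asymp g(n)$ means $C^{-1}g(n)\le f(n)\le Cg(n)$ for all large $n$ with a constant $C>0$ (which may depend on $c$ and the law of $\xi$). The edge value is the (finite, deterministic) norm of the limiting circular element of variance $\mathbb E\xi^2$, namely $2(\mathbb E\xi^2)^{1/2}$, to which $\|X_n\|$ converges in probability under a finite fourth moment. *)

(* Defs.v *)
From HB Require Import structures.
From mathcomp Require Import all_boot all_order all_algebra.
From mathcomp Require Import all_classical all_reals all_analysis.
From mathcomp Require Import complex.

Set Implicit Arguments.
Unset Strict Implicit.
Unset Printing Implicit Defensive.

Import Order.TTheory GRing.Theory Num.Theory.
Import numFieldNormedType.Exports.

Local Open Scope classical_set_scope.
Local Open Scope ring_scope.
Local Open Scope complex_scope.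

Definition asymp (R : realType) (T : Type) (F : set_system T) (f g : T -> R) :=
  exists2 C : R, 0 < C & \forall x \near F, C^-1 * g x <= f x <= C * g x.

Section Probability.
Context (R : realType).

Definition symmetric_law (d : measure_display) (T : measurableType d)
    (P : probability T R) (X : {RV P >-> R}) :=
  forall A : set R, measurable A ->
    distribution P X A = distribution P X (-%R @^-1` A).

Definition same_law (d d' : measure_display)
    (T : measurableType d) (T' : measurableType d')
    (P : probability T R) (P' : probability T' R)
    (X : {RV P >-> R}) (Y : {RV P' >-> R}) :=
  forall A : set R, measurable A -> distribution P X A = distribution P' Y A.

Definition mutually_independent (d : measure_display) (T : measurableType d)
    (P : probability T R) (I : eqType) (F : I -> set (set T)) :=
  forall (s : seq I) (A : I -> set T), uniq s ->
    (forall i, i \in s -> F i (A i)) ->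
    P (\big[setI/setT]_(i <- s) A i) = (\prod_(i <- s) P (A i))%E.

Context (d : measure_display) (T : measurableType d) (P : probability T R).

Definition sigma_rv (X : {RV P >-> R}) : set (set T) :=
  [set X @^-1` B | B in measurable].

Definition sigma_mx (n : nat) (X : 'I_n -> 'I_n -> {RV P >-> R}) :
    set (set T) :=
  <<s \bigcup_ij sigma_rv (X ij.1 ij.2) >>.

Definition iid_entries (d0 : measure_display) (T0 : measurableType d0)
    (P0 : probability T0 R) (xi : {RV P0 >-> R})
    (n : nat) (X : 'I_n -> 'I_n -> {RV P >-> R}) :=
  (forall i j, same_law (X i j) xi) /\
  mutually_independent P (fun ij : 'I_n * 'I_n => sigma_rv (X ij.1 ij.2)).

(* The base value 0 only matters for n = 0, the other terms being >= 0. *)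
Definition max_entry (n : nat) (X : 'I_n -> 'I_n -> {RV P >-> R}) (w : T) : R :=
  \big[Num.max/0]_(i < n) \big[Num.max/0]_(j < n) `|X i j w|.

(* n^(-1/2) X, viewed as a complex matrix. *)
Definition scaled_mx (n : nat) (X : 'I_n -> 'I_n -> {RV P >-> R}) (w : T) :
    'M[R[i]]_n :=
  \matrix_(i, j) ((Num.sqrt n%:R)^-1 * X i j w)%:C.

End Probability.

Section OperatorNorm.
Context (R : realType).

Definition l2norm (n : nat) (v : 'cV[R[i]]_n) : R :=
  Num.sqrt (\sum_(i < n) Normc.normc (v i 0) ^+ 2).

(* The norm as an operator on C^n; for a real matrix this equals the norm as
   an operator on R^n. *)
Definition opnorm (n : nat) (A : 'M[R[i]]_n) : R :=
  sup [set l2norm (A *m v) | v in [set v : 'cV[R[i]]_n | l2norm v <= 1]].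

End OperatorNorm.

Section StrongConvergence.
Context (R : realType).

(* A unital C*-algebra with a faithful state. *)
Record cstar_probability_space := CstarProbabilitySpace {
  cstar_sort :> algType R[i];
  star : cstar_sort -> cstar_sort;
  cnorm : cstar_sort -> R;
  state : cstar_sort -> R[i];
  starD : forall a b, star (a + b) = star a + star b;
  starZ : forall (k : R[i]) a, star (k *: a) = k^* *: star a;
  starM : forall a b, star (a * b) = star b * star a;
  starK : forall a, star (star a) = a;
  cnorm_eq0 : forall a, cnorm a = 0 -> a = 0;
  cnormD : forall a b, cnorm (a + b) <= cnorm a + cnorm b;
  cnormZ : forall (k : R[i]) a, cnorm (k *: a) = Normc.normc k * cnorm a;
  cnormM : forall a b, cnorm (a * b) <= cnorm a * cnorm b;
  cnorm_star : forall a, cnorm (star a * a) = cnorm a ^+ 2;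
  cnorm_complete : forall u : nat -> cstar_sort,
    (forall e : R, 0 < e ->
       exists N, forall m n, (N <= m)%N -> (N <= n)%N ->
         cnorm (u m - u n) < e) ->
    exists l, cnorm (u n - l) @[n --> \oo] --> (0 : R);
  stateD : forall a b, state (a + b) = state a + state b;
  stateZ : forall (k : R[i]) a, state (k *: a) = k * state a;
  state1 : state 1 = 1;
  state_ge0 : forall a, 0 <= state (star a * a);
  state_faithful : forall a, state (star a * a) = 0 -> a = 0
}.

Context (A : cstar_probability_space).

(* Standard semicircular: the even moments are the Catalan numbers. *)
Definition semicircular (s : A) :=
  star s = s /\
  forall k, state (s ^+ k) =
    if odd k then 0 else ('C(k, k./2) %/ (k./2).+1)%:R.

(* Freeness of the unital subalgebras generated by a and b: the state vanishes
   on alternating products of centered elements, the first factor being taken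
   from the algebra of b if swap, and from that of a otherwise. *)
Definition free_pair (a b : A) :=
  forall (swap : bool) (ps : seq {poly R[i]}),
    let factor k := horner_alg (if odd k (+) swap then b else a) ps`_k in
    (0 < size ps)%N ->
    (forall k, (k < size ps)%N -> state (factor k) = 0) ->
    state (\prod_(k < size ps) factor k) = 0.

Definition circular (sigma : R) (x : A) :=
  exists s1 s2 : A,
    [/\ semicircular s1, semicircular s2, free_pair s1 s2 &
        x = (sigma / Num.sqrt 2)%:C *: (s1 + 'i *: s2)].

Inductive starpoly :=
  | SVar
  | SConst of R[i]
  | SAdd of starpoly & starpoly
  | SMul of starpoly & starpoly
  | SStar of starpoly.

Fixpoint eval_alg (x : A) (p : starpoly) : A :=
  match p with
  | SVar => x
  | SConst k => k%:A
  | SAdd p q => eval_alg x p + eval_alg x q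
  | SMul p q => eval_alg x p * eval_alg x q
  | SStar p => star (eval_alg x p)
  end.

Fixpoint eval_mx (n : nat) (M : 'M[R[i]]_n) (p : starpoly) : 'M[R[i]]_n :=
  match p with
  | SVar => M
  | SConst k => k%:M
  | SAdd p q => eval_mx M p + eval_mx M q
  | SMul p q => eval_mx M p *m eval_mx M q
  | SStar p => map_mx conjc (eval_mx M p)^T
  end.

Definition converges_strongly (M : forall n, 'M[R[i]]_n) (x : A) :=
  forall p : starpoly,
    opnorm (eval_mx (M n) p) @[n --> \oo] --> cnorm (eval_alg x p).

End StrongConvergence.

(* Each matrix has i.i.d. entries, but nothing is assumed on the joint law of
   matrices of different sizes. *)
Definition strong_convergence_for_every_coupling (R : realType) : Prop :=
  forall (d0 : measure_display) (T0 : measurableType d0)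
    (P0 : probability T0 R) (xi : {RV P0 >-> R}),
  symmetric_law xi -> ('E_P0[fun w => (`|xi w| ^+ 4)%R] < +oo)%E ->
  forall (d : measure_display) (T : measurableType d) (P : probability T R)
    (X : forall n : nat, 'I_n -> 'I_n -> {RV P >-> R}),
  (forall n, iid_entries xi (X n)) ->
  exists (A : cstar_probability_space R) (x : A),
    circular (Num.sqrt (fine 'E_P0[fun w => (xi w ^+ 2)%R])) x /\
    {ae P, forall w, converges_strongly (fun n => scaled_mx (X n) w) x}.

(* Main.v *)
Require Import Defs.
From HB Require Import structures.
From mathcomp Require Import all_boot all_order all_algebra.
From mathcomp Require Import all_classical all_reals all_analysis.
From mathcomp Require Import measurable_realfun complex ring lra.

Set Implicit Arguments.
Unset Strict Implicit.
Unset Printing Implicit Defensive.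

Import Order.TTheory GRing.Theory Num.Theory.
Import numFieldNormedType.Exports.

Local Open Scope classical_set_scope.
Local Open Scope ring_scope.

(* The union bound and independence of the entries give, with
   g n = n ^ 2 * P (c * sqrt n < |xi|) of order (ln n) ^ -2,
   g / (1 + g) <= P (E n) <= g; the lower bound comes from
   \prod (1 - p i) * (1 + \sum p i) <= 1. The same inequality yields the second
   Borel-Cantelli lemma. Every entry of a matrix is bounded by the operator norm,
   so the norm almost surely exceeds any c infinitely often, whereas convergence
   would bound it. The fourth moment is summed over dyadic levels 2 ^ k, where the
   tail contributes a constant times k ^ -2. *)

(** * Inequalities between products and sums, and tails of divergent series *)

(** Induction on the list: prepending a factor [1 - p] to a product [q] with sum [S] lowers
    [q (1 + S)] by [q p (p + S)], which is nonnegative. Nonnegativity of [q] and [S] is therefore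
    carried along. *)
Lemma prod_onem_mul_sum_le1 (R : realFieldType) (I : Type) (s : seq I)
    (p : I -> R) : (forall i, 0 <= p i <= 1) ->
  0 <= \prod_(i <- s) (1 - p i) /\
  (\prod_(i <- s) (1 - p i)) * (1 + \sum_(i <- s) p i) <= 1.
Proof.
move=> p01; suff [//] : [/\ 0 <= \prod_(i <- s) (1 - p i),
  0 <= \sum_(i <- s) p i &
  (\prod_(i <- s) (1 - p i)) * (1 + \sum_(i <- s) p i) <= 1].
elim: s => [|i s [q0 S0 qS]].
  by rewrite !big_nil addr0 mulr1.
have /andP[p0 p1] := p01 i.
rewrite !big_cons; move: q0 S0 qS.
set q := \prod_(_ <- _) _; set S := \sum_(_ <- _) _ => q0 S0 qS; split.
- by rewrite mulr_ge0 // subr_ge0.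
- by rewrite addr_ge0.
- have : 0 <= q * (p i * (p i + S)) by rewrite !(mulr_ge0, addr_ge0).
  nra.
Qed.

(** Weierstrass product inequality; for independent events it is the union bound read on
    complements. *)
Lemma prod_onem_ge_onem_sum (R : realFieldType) (I : Type) (s : seq I)
    (p : I -> R) : (forall i, 0 <= p i <= 1) ->
  1 - \sum_(i <- s) p i <= \prod_(i <- s) (1 - p i).
Proof.
move=> p01; elim: s => [|i s]; first by rewrite !big_nil subr0.
have /andP[p0 p1] := p01 i.
rewrite !big_cons.
have : \prod_(j <- s) (1 - p j) <= 1.
  apply: prodr_ile1 => j _; have /andP[pj0 pj1] := p01 j.
  by rewrite subr_ge0 pj1 gerBl.
nra.
Qed.

Lemma le_inv_add1 (R : realFieldType) (q S : R) :
  0 <= S -> q * (1 + S) <= 1 -> q <= (1 + S)^-1.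
Proof. by move=> S0 qS; rewrite -[leRHS]mul1r ler_pdivlMr // ltr_pwDl. Qed.

(** Otherwise all partial sums would stay below the sum of the first [N] terms plus [B]. *)
Lemma nneseries_pinfty_tail_ge (R : realType) (u : nat -> R) (B : R) (N : nat) :
  (forall n, 0 <= u n) -> (\sum_(0 <= n <oo) (u n)%:E = +oo)%E ->
  exists M, B <= \sum_(N <= n < M) u n.
Proof.
move=> u0 sumu; apply: contrapT => /forallNP noM.
suff : (\sum_(0 <= n <oo) (u n)%:E <= (\sum_(0 <= n < N) u n + B)%:E)%E.
  by rewrite sumu leye_eq.
apply: lime_le; first by apply: is_cvg_nneseries => n _ _; rewrite lee_fin.
apply: nearW => M; rewrite sumEFin lee_fin.
have [MN|NM] := leP M N.
  (* The negated claim at [M = N], where the sum is empty, gives [B > 0]. *)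
  have B0 : 0 <= B.
    by have /negP := noM N; rewrite big_geq // -ltNge => /ltW.
  rewrite -[leLHS]addr0 lerD // (big_cat_nat (leq0n _) MN) /= lerDl.
  by rewrite sumr_ge0.
rewrite (big_cat_nat (leq0n _) (ltnW NM)) /= lerD2l.
by have /negP := noM M; rewrite -ltNge => /ltW.
Qed.

(** * Independent events and the second Borel-Cantelli lemma *)

Section IndependentEvents.
Context (R : realType) (d : measure_display) (T : measurableType d).
Variable P : probability T R.

Lemma fine_probability_itv (A : set T) : measurable A -> 0 <= fine (P A) <= 1.
Proof.
by move=> mA; rewrite fine_ge0 //= -lee_fin fineK ?fin_num_measure // probability_le1.
Qed.

Lemma fine_probability_setC (A : set T) : measurable A ->
  fine (P (~` A)) = 1 - fine (P A).
Proof. by move=> mA; rewrite probability_setC // fineB ?fin_num_measure. Qed.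

(** Membership in [F i] is asked of the complements, because [F i] is an arbitrary family, not
    assumed closed under complement. *)
Lemma prob_bigcap_independent (I : eqType) (F : I -> set (set T)) (s : seq I)
    (A : I -> set T) : mutually_independent P F -> uniq s ->
  (forall i, measurable (A i)) -> (forall i, F i (~` A i)) ->
  P (\big[setI/setT]_(i <- s) ~` A i) =
  (\prod_(i <- s) (1 - fine (P (A i))))%:E.
Proof.
move=> indF us mA FA; rewrite indF // -prodEFin; apply: eq_bigr => i _.
by rewrite -fine_probability_setC // fineK // fin_num_measure //; exact: measurableC.
Qed.

(* The probability that none of the [A i], [N <= i < M], occurs is at most
   [1 / (1 + S)], where [S] is the sum of the probabilities. *)
Lemma borel_cantelli2 (F : nat -> set (set T)) (A : nat -> set T) :
  mutually_independent P F ->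
  (forall n, measurable (A n)) -> (forall n, F n (~` A n)) ->
  (\sum_(0 <= n <oo) P (A n) = +oo)%E ->
  {ae P, forall w, forall N, exists2 n, (N <= n)%N & A n w}.
Proof.
move=> indF mA FA sumA.
have tail0 N : P (\bigcap_(n in [set n | (N <= n)%N]) ~` A n) = 0%E.
  set B := \bigcap_(n in _) _.
  have mB : measurable B.
    by apply: bigcap_measurableType => n _; exact: measurableC.
  apply/eqP; rewrite eq_le measure_ge0 andbT; apply/lee_addgt0Pr => e e0.
  (* Once [S] is at least [1 / e], the bound [1 / (1 + S)] is below [e]. *)
  have [M SM] : exists M, e^-1 <= \sum_(N <= n < M) fine (P (A n)).
    apply: nneseries_pinfty_tail_ge => [n|].
      by have /andP[] := fine_probability_itv (mA n).
    by rewrite -[RHS]sumA; apply: eq_eseriesr => n _; rewrite fineK ?fin_num_measure.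
  rewrite add0e.
  have [q0 qS] := prod_onem_mul_sum_le1 (index_iota N M)
    (p := fun n => fine (P (A n))) (fun n => fine_probability_itv (mA n)).
  have S0 : 0 <= \sum_(N <= n < M) fine (P (A n)).
    by apply: sumr_ge0 => n _; have /andP[] := fine_probability_itv (mA n).
  apply: (@le_trans _ _ (P (\big[setI/setT]_(n <- index_iota N M) ~` A n))).
    apply: le_measure; rewrite ?inE //.
      rewrite -bigcap_seq; apply: fin_bigcap_measurable => // n _.
      exact: measurableC.
    rewrite -bigcap_seq => w Bw n /=; rewrite mem_index_iota => /andP[Nn _].
    exact: Bw.
  rewrite (prob_bigcap_independent indF) ?iota_uniq // lee_fin.
  apply: le_trans (le_inv_add1 S0 qS) _.
  rewrite -[leRHS]invrK lef_pV2 ?posrE ?invr_gt0 ?ltr_pwDl //.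
  by apply: le_trans SM _; rewrite lerDr.
rewrite /almost_everywhere /=.
(* The exceptional points lie in the countable union over [N] of the null events of [tail0]. *)
apply: (@negligibleS _ _ _ _ (\bigcup_N \bigcap_(n in [set n | (N <= n)%N]) ~` A n)).
  move=> w /existsNP[N nA]; exists N => // n Nn An; apply: nA; by exists n.
apply: negligible_bigcup => N; apply/negligibleP; last exact: tail0.
by apply: bigcap_measurableType => n _; exact: measurableC.
Qed.

End IndependentEvents.

(** * Distribution of the maximal entry *)

Lemma measurable_abs_gt (R : realType) (t : R) :
  measurable [set x : R | t < `|x|].
Proof.
have := @normr_measurable R setT measurableT [set` `]t, +oo[] (measurable_itv _).
by rewrite setTI; congr measurable; apply/seteqP; split=> x /=;
  rewrite in_itv /= andbT.
Qed.

Section MaxEntry.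
Context (R : realType) (d0 : measure_display) (T0 : measurableType d0).
Context (P0 : probability T0 R) (xi : {RV P0 >-> R}).
Context (d : measure_display) (T : measurableType d) (P : probability T R).
Context (n : nat) (X : 'I_n -> 'I_n -> {RV P >-> R}).

(** Nonnegativity of [t] prevents the base value 0 of the nested maxima from being what exceeds
    [t]. *)
Lemma max_entry_gtP (t : R) (w : T) : 0 <= t ->
  (t < max_entry X w) <-> exists ij, t < `|X ij.1 ij.2 w|.
Proof.
move=> t0; rewrite /max_entry; split.
  move/bigmax_gtP => [|[i _ /bigmax_gtP[|[j _ tX]]]]; rewrite ?(le_gtF t0) //.
  by exists (i, j).
move=> [[i j] tX]; apply/bigmax_gtP; right; exists i => //.
by apply/bigmax_gtP; right; exists j.
Qed.

Let far (t : R) (ij : 'I_n * 'I_n) := [set w | t < `|X ij.1 ij.2 w|].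

Let setC_max_entry (t : R) : 0 <= t ->
  ~` [set w | t < max_entry X w] =
  \big[setI/setT]_(ij <- enum {: 'I_n * 'I_n}) ~` far t ij.
Proof.
move=> t0; rewrite -bigcap_seq; apply/seteqP; split => w /=.
  by move=> nE ij _ tX; apply: nE; apply/max_entry_gtP => //; exists ij.
by move=> far0 /(max_entry_gtP _ t0)[ij]; apply: far0; rewrite /= mem_enum.
Qed.

Let sigma_farC (t : R) ij : sigma_rv (X ij.1 ij.2) (~` far t ij).
Proof.
exists (~` [set x : R | t < `|x|]) => //.
by apply: measurableC; exact: measurable_abs_gt.
Qed.

Let measurable_far (t : R) ij : measurable (far t ij).
Proof. exact: (measurable_funPTI (X ij.1 ij.2) (measurable_abs_gt t)). Qed.

(** Brings the events on the maximal entry under the independence of the matrices, in the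
    complemented form that [borel_cantelli2] takes. *)
Lemma sigma_mx_max_entry (t : R) : 0 <= t ->
  sigma_mx X (~` [set w | t < max_entry X w]).
Proof.
move=> t0; rewrite setC_max_entry //.
(* The finite intersection is taken in the measurable space carried by the generated
   sigma-algebra. *)
apply: (@bigsetI_measurable _
  (g_sigma_algebraType (\bigcup_ij sigma_rv (X ij.1 ij.2)))) => ij _.
apply: sub_sigma_algebra; exists ij => //; exact: sigma_farC.
Qed.

Lemma measurable_max_entry_gt (t : R) : 0 <= t ->
  measurable [set w | t < max_entry X w].
Proof.
move=> t0; rewrite -[X in measurable X]setCK; apply: measurableC.
rewrite setC_max_entry //; apply: bigsetI_measurable => ij _.
exact: measurableC.
Qed.

(** Here [g] is the expected number of entries exceeding [t] in modulus. By independence the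
    complementary probability is a product, which lies between [1 - g] and [1 / (1 + g)]. *)
Lemma max_entry_tail (t g : R) : iid_entries xi X -> 0 <= t ->
  g = n%:R ^+ 2 * fine (P0 [set w | t < `|xi w|]) ->
  g / (1 + g) <= fine (P [set w | t < max_entry X w]) <= g.
Proof.
move=> [lawX indX] t0 gE0.
have gE : g = \sum_(ij <- enum {: 'I_n * 'I_n}) fine (P (far t ij)).
  under eq_bigr => ij _.
    rewrite (_ : fine _ = fine (P0 [set w | t < `|xi w|])); last first.
      by rewrite -[RHS]/(fine (distribution P0 xi [set x | t < `|x|]))
         -(lawX ij.1 ij.2) //; exact: measurable_abs_gt.
    over.
  rewrite big_const_seq count_predT -cardT card_prod card_ord iter_addr_0.
  by rewrite -mulr_natl natrM -expr2 gE0.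
have g0 : 0 <= g by rewrite gE sumr_ge0 // => ij _; rewrite fine_ge0.
have mE := measurable_max_entry_gt t0.
have PE : 1 - fine (P [set w | t < max_entry X w]) =
    \prod_(ij <- enum {: 'I_n * 'I_n}) (1 - fine (P (far t ij))).
  rewrite -fine_probability_setC // setC_max_entry //.
  rewrite (prob_bigcap_independent indX) ?enum_uniq //.
apply/andP; split.
  have [_] := prod_onem_mul_sum_le1 (enum {: 'I_n * 'I_n})
    (p := fun ij => fine (P (far t ij)))
    (fun ij => fine_probability_itv P (measurable_far t ij)).
  rewrite -PE -gE => /(le_inv_add1 g0); rewrite lerBlDl => h.
  have -> : g / (1 + g) = 1 - (1 + g)^-1 by field; rewrite gt_eqF // ltr_pwDl.
  by rewrite lerBlDr.
have := prod_onem_ge_onem_sum (enum {: 'I_n * 'I_n})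
  (p := fun ij => fine (P (far t ij)))
  (fun ij => fine_probability_itv P (measurable_far t ij)).
by rewrite -PE -gE lerD2l lerN2.
Qed.

End MaxEntry.

(** * The operator norm dominates every entry *)

Section OperatorNormEntry.
Context (R : realType) (n : nat).
Local Notation C := (complex R).

Lemma normc_le_l2norm (v : 'cV[C]_n) i : Normc.normc (v i 0) <= l2norm v.
Proof.
rewrite -[leLHS]ger0_norm; last by case: (v i 0) => a b; exact: sqrtr_ge0.
rewrite -sqrtr_sqr ler_wsqrtr // (bigD1 i) //= lerDl.
by apply: sumr_ge0 => j _; exact: sqr_ge0.
Qed.

(** The entry is coordinate [i] of the image of the unit vector [delta_mx j 0]. Boundedness has to
    be proved first, as [sup] of an unbounded set defaults to 0. *)
Lemma normc_entry_le_opnorm (A : 'M[C]_n) i j :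
  Normc.normc (A i j) <= opnorm A.
Proof.
pose r k := \sum_l Normc.normc (A k l).
have n0 k : 0 <= Normc.normc k :> R by case: k => a b; exact: sqrtr_ge0.
have ubA : has_ubound [set l2norm (A *m v) | v in [set v : 'cV_n | l2norm v <= 1]].
  (* The coordinates of [v] have modulus at most 1, so coordinate [k] of the image is at most the
     sum [r k] of the moduli in row [k]. *)
  exists (Num.sqrt (\sum_k r k ^+ 2)) => _ [v /= v1 <-].
  rewrite /l2norm ler_wsqrtr // ler_sum // => k _.
  rewrite lerXn2r ?nnegrE ?sumr_ge0 // mxE.
  (* The norm of [R[i]] is [normc] embedded as a complex number; passing to it gives the triangle
     inequality for sums. *)
  rewrite -lecR (_ : real_complex R _ = `|\sum_l A k l * v l 0|) //.
  apply: le_trans (ler_norm_sum _ _ _) _.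
  rewrite /r rmorph_sum ler_sum // => l _.
  rewrite -[leLHS]/(real_complex R (Normc.normc (A k l * v l 0))) lecR.
  rewrite Normc.normcM ler_piMr //.
  exact: le_trans (normc_le_l2norm _ _) v1.
apply: le_trans (_ : l2norm (A *m delta_mx j 0) <= _).
  by apply: le_trans (normc_le_l2norm _ i); rewrite -colE mxE.
apply: ub_le_sup => //; exists (delta_mx j 0) => //=.
rewrite /l2norm (bigD1 j) //= big1 => [|k kj].
  by rewrite mxE !eqxx Normc.normc1 expr1n addr0 sqrtr1.
by rewrite mxE (negPf kj) Normc.normc0 expr0n.
Qed.

End OperatorNormEntry.

Lemma max_entry_lt_opnorm (R : realType) (d : measure_display)
    (T : measurableType d) (P : probability T R) (n : nat)
    (X : 'I_n -> 'I_n -> {RV P >-> R}) (c : R) (w : T) : 0 <= c ->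
  c * Num.sqrt n%:R < max_entry X w -> c < opnorm (scaled_mx X w).
Proof.
move=> c0 /max_entry_gtP [|[i j] /= cX]; first by rewrite mulr_ge0 ?sqrtr_ge0.
have n0 : 0 < Num.sqrt n%:R :> R.
  by rewrite sqrtr_gt0 ltr0n (leq_ltn_trans _ (ltn_ord i)).
apply: lt_le_trans (normc_entry_le_opnorm _ i j).
rewrite mxE /= expr0n addr0 sqrtr_sqr normrM gtr0_norm ?invr_gt0 //.
by rewrite mulrC ltr_pdivlMr.
Qed.

(** * Finite fourth moment and zero mean *)

Section MomentsFromTail.
Context (R : realType).

Lemma series_inv_sqr_le2 (n : nat) : \sum_(0 <= k < n) (k.+1%:R ^- 2 : R) <= 2.
Proof.
(* The strengthened bound telescopes: its increment [2 / ((n + 1) (n + 2))] is at least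
   [1 / (n + 1)^2]. *)
suff : \sum_(0 <= k < n) (k.+1%:R ^- 2 : R) <= 2 * (1 - n.+1%:R^-1).
  by move=> /le_trans; apply; rewrite ler_piMr // gerBl invr_ge0.
elim: n => [|n IHn]; first by rewrite big_geq // invr1 subrr mulr0.
rewrite big_nat_recr //=; apply: le_trans (lerD IHn (lexx _)) _.
rewrite -subr_ge0.
have -> : 2 * (1 - n.+2%:R^-1) - (2 * (1 - n.+1%:R^-1) + n.+1%:R ^- 2) =
  n%:R / (n.+1%:R ^+ 2 * n.+2%:R) :> R.
  rewrite -![in n.+2%:R]natr1 -![in n.+1%:R]natr1; field.
  by rewrite !natr1 !pnatr_eq0.
by rewrite divr_ge0 // mulr_ge0.
Qed.

(** The constant covers small [x]; otherwise [x] lies in one dyadic shell, and the single series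
    term of that shell suffices. *)
Lemma expr4_le_dyadic (k0 : nat) (x : R) :
  ((`|x| ^+ 4)%:E <= (16 ^+ k0)%:E +
    \sum_(0 <= k <oo) (16 ^+ (k0 + k).+1 * \1_[set y : R | 2 ^+ (k0 + k) < `|y|] x)%:E)%E.
Proof.
have t0 n : (0 <= ((16 : R) ^+ (k0 + n).+1 * \1_[set y : R | 2 ^+ (k0 + n) < `|y|] x)%:E)%E.
  by rewrite lee_fin mulr_ge0 ?exprn_ge0.
have [xk0|k0x] := leP `|x| (2 ^+ k0).
  apply: (@le_trans _ _ (16 ^+ k0)%:E); last first.
    by rewrite leeDl // nneseries_ge0 // => n _ _; exact: t0.
  rewrite lee_fin (_ : 16 = 2 ^+ 4 :> R); last by ring.
  by rewrite -exprM mulnC exprM lerXn2r ?nnegrE ?exprn_ge0.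
have [m xm] : exists m, `|x| <= 2 ^+ (k0 + m).
  have [m] : exists m, `|x| <= m%:R by exists (Num.trunc `|x|).+1; rewrite ltW // truncnS_gt.
  move=> xm; exists m; apply: le_trans xm _.
  by rewrite -natrX ler_nat (leq_trans (ltnW (ltn_expl m (ltnSn 1)))) // leq_exp2l ?leq_addl.
have exm : exists m, `|x| <= 2 ^+ (k0 + m) by exists m.
(* The least level above [x] is a successor since [x] exceeds level [k0]; minimality puts [x] above
   the preceding level. *)
case: (ex_minnP exm) => -[|k] xk kmin; first by rewrite addn0 leNgt k0x in xk.
have kx : 2 ^+ (k0 + k) < `|x|.
  by rewrite ltNge; apply/negP => /kmin; rewrite ltnn.
apply: (le_trans _ (leeDr _ _)); last by rewrite lee_fin exprn_ge0.
apply: (le_trans _ (nneseries_lim_ge (P := xpredT) k.+1 (fun n _ _ => t0 n))).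
rewrite big_nat_recr //= -[leLHS]add0e leeD //.
  by apply: sume_ge0 => n _; exact: t0.
rewrite lee_fin indicE mem_set // mulr1 -addnS (_ : 16 = 2 ^+ 4 :> R); last by ring.
by rewrite -exprM mulnC exprM lerXn2r ?nnegrE ?exprn_ge0.
Qed.

Context (d : measure_display) (T : measurableType d) (P : probability T R).
Variable xi : {RV P >-> R}.

Lemma fourth_moment_finite (C : R) : 0 <= C ->
  (\forall t \near +oo, fine (P [set w | t < `|xi w|]) <= C * (t ^- 4 * ln t ^- 2)) ->
  ('E_P[fun w => (`|xi w| ^+ 4)%R] < +oo)%E.
Proof.
move=> C0 tail.
(* All levels from [k0] on are beyond the threshold of [tail]; positivity of [k0] later gives
   [k0 + k >= k + 1]. *)
have [k0 [k00 tailk]] : exists k0 : nat, (0 < k0)%N /\ forall k,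
   fine (P [set w | 2 ^+ (k0 + k) < `|xi w|]) <=
   C * ((2 ^+ (k0 + k)) ^- 4 * ln (2 ^+ (k0 + k)) ^- 2).
  have [M [_ HM]] := tail.
  exists (Num.trunc `|M|).+1; split=> // k; apply: HM.
  apply: le_lt_trans (ler_norm M) _; apply: lt_le_trans (truncnS_gt _) _.
  by rewrite -natrX ler_nat (leq_trans (ltnW (ltn_expl _ (ltnSn 1)))) // leq_exp2l ?leq_addr.
have mX k : measurable [set w | 2 ^+ (k0 + k) < `|xi w|].
  exact: (measurable_funPTI xi (measurable_abs_gt _)).
pose a k : R := 16 ^+ (k0 + k).+1.
pose B k := [set w | 2 ^+ (k0 + k) < `|xi w|].
(* The 16 is the fourth power of the ratio of consecutive levels; [ln 2] comes from the logarithm of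
   [2 ^+ (k0 + k)]. *)
pose D := 16 * C * ln (2 : R) ^- 2.
have ln2 : 0 < ln (2 : R) by rewrite ln_gt0 // ltr1n.
have D0 : 0 <= D by rewrite !mulr_ge0 // invr_ge0 exprn_ge0 // ltW.
have aB k : a k * fine (P (B k)) <= D * k.+1%:R ^- 2.
  have a0 : 0 < a k by rewrite exprn_gt0.
  apply: le_trans (ler_wpM2l (ltW a0) (tailk k)) _.
  rewrite lnXn // -(mulr_natl (ln 2)) /D /a (exprS 16) -exprM mulnC exprM.
  rewrite (_ : 2 ^+ 4 = 16 :> R); last by ring.
  set q := 16 ^+ (k0 + k); have q0 : q != 0 by rewrite expf_neq0.
  have -> : 16 * q * (C * (q^-1 * ((k0 + k)%:R * ln 2) ^- 2)) =
    16 * C * ln 2 ^- 2 * (k0 + k)%:R ^- 2.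
    rewrite exprMn invfM; move: (ln 2 ^- 2) ((k0 + k)%:R ^- 2) => u v.
    by field.
  rewrite ler_wpM2l // lef_pV2 ?posrE ?exprn_gt0 ?ltr0n ?addn_gt0 ?k00 //.
  by rewrite lerXn2r ?nnegrE // ler_nat -add1n leq_add2r.
have mB k : measurable_fun setT (fun w => (a k * \1_(B k) w)%:E).
  by apply/measurable_EFinP; apply: measurable_funM => //; apply: measurable_indic; exact: mX.
have B0 k w : (0 <= (a k * \1_(B k) w)%:E)%E.
  by rewrite lee_fin mulr_ge0 ?exprn_ge0.
have mS : measurable_fun setT (fun w => \sum_(0 <= k <oo) (a k * \1_(B k) w)%:E)%E.
  exact: ge0_emeasurable_sum.
rewrite unlock.
apply: (@le_lt_trans _ _ (\int[P]_w ((16 ^+ k0)%:E +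
   \sum_(0 <= k <oo) (a k * \1_(B k) w)%:E))%E).
  apply: ge0_le_integral => //=.
  - apply/measurable_EFinP; apply: measurable_funX.
    exact: (measurableT_comp (@normr_measurable R setT) (measurable_funP xi)).
  - exact: emeasurable_funD.
  - move=> w _; apply: le_trans (expr4_le_dyadic k0 (xi w)) _.
    by rewrite leeD2l //; apply: lee_nneseries.
rewrite ge0_integralD //; last by move=> w _; rewrite nneseries_ge0.
rewrite integral_cst // [X in (_ * X)%E]probability_setT mule1 lte_add_pinfty ?ltry //.
rewrite integral_nneseries //.
apply: (@le_lt_trans _ _ (D * 2)%:E); last by rewrite ltry.
apply: lime_le.
  by apply: is_cvg_nneseries => n _ _; apply: integral_ge0.
apply: nearW => n.
apply: (@le_trans _ _ (\sum_(0 <= k < n) (D * k.+1%:R ^- 2)%:E)%E).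
  apply: lee_sum => k _.
  under eq_integral do rewrite EFinM.
  rewrite ge0_integralZl_EFin ?exprn_ge0 //; last first.
    by apply/measurable_EFinP; apply: measurable_indic; exact: mX.
  have mBk : measurable (B k) by exact: mX.
  rewrite integral_indic // setIT -[X in (_ * X)%E]fineK ?fin_num_measure //.
  by rewrite -EFinM lee_fin.
by rewrite sumEFin lee_fin -mulr_sumr ler_wpM2l // series_inv_sqr_le2.
Qed.

(** Integrability follows from [|x| <= 1 + |x|^4]; then [xi] and [- xi] have the same law, so the
    mean equals its opposite. *)
Lemma symmetric_mean0 : symmetric_law xi ->
  ('E_P[fun w => (`|xi w| ^+ 4)%R] < +oo)%E -> ('E_P[xi] = 0)%E.
Proof.
move=> sym m4; rewrite unlock in m4.
have mxi : measurable_fun setT xi by exact: measurable_funP.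
have mabs : measurable_fun setT (fun w => `|xi w|).
  exact: (measurableT_comp (@normr_measurable R setT) mxi).
have mpow : measurable_fun setT (fun w => (`|xi w| ^+ 4)%:E).
  by apply/measurable_EFinP; exact: measurable_funX.
have intxi : P.-integrable setT (EFin \o xi).
  apply/integrableP; split; first exact/measurable_EFinP.
  apply: (@le_lt_trans _ _ (\int[P]_w (1%:E + (`|xi w| ^+ 4)%:E))%E).
    apply: ge0_le_integral => //=.
    - exact/measurable_EFinP.
    - exact: emeasurable_funD.
    - move=> w _; rewrite -EFinD lee_fin.
      have [x1|x1] := leP `|xi w| 1.
        by rewrite (le_trans x1) // lerDl exprn_ge0.
      by rewrite -[leLHS]add0r lerD // ler_eXnr // ltW.
  rewrite ge0_integralD //.
  by rewrite integral_cst // [X in (_ * X)%E]probability_setT mule1 lte_add_pinfty ?ltry.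
have mid : measurable_fun setT (@EFin R) by [].
pose Y : {RV P >-> R} := - xi.
have E1 : ('E_P[xi] = \int[distribution P xi]_y y%:E)%E.
  by rewrite unlock integral_distribution.
have E2 : (- 'E_P[xi] = \int[distribution P Y]_y y%:E)%E.
  transitivity (\int[P]_w - (xi w)%:E)%E.
    by rewrite unlock [RHS]integralN //; exact: integrable_add_def.
  by rewrite [RHS](integral_distribution (X := Y)) //; exact: (integrableN intxi).
have fE : 'E_P[xi]%E \is a fin_num by rewrite unlock; exact: integrable_fin_num.
have Eopp : ('E_P[xi] = - 'E_P[xi])%E.
  (* The law of [Y] at [A] unfolds to the law of [xi] at the reflected set. *)
  rewrite E2 E1; apply: eq_measure_integral => A mA _; exact: sym.
have e0 : fine 'E_P[xi]%E = 0.
  by have := congr1 fine Eopp; rewrite fineN; lra.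
by rewrite -(fineK fE) e0.
Qed.

End MomentsFromTail.

(** * Asymptotics at the scale [c * sqrt n] *)

Section Asymptotics.
Context (R : realType).

Lemma sqrtr_natr_sqr (n : nat) : Num.sqrt n%:R ^+ 2 = n%:R :> R.
Proof. by rewrite sqr_sqrtr. Qed.

Lemma near_natr_ge (x : R) : \forall n \near \oo, x <= n%:R.
Proof.
exists (Num.trunc `|x|).+1 => // n /= xn.
rewrite (le_trans (ler_norm x)) // (le_trans (ltW (truncnS_gt _))) //.
by rewrite ler_nat.
Qed.

Lemma near_sqrt_gt (c M : R) : 0 < c -> \forall n \near \oo, M < c * Num.sqrt n%:R.
Proof.
move=> c0; apply: filterS (near_natr_ge ((`|M| / c + 1) ^+ 2)) => n hn.
apply: le_lt_trans (ler_norm M) _; rewrite -ltr_pdivrMl // mulrC.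
rewrite -[ltLHS]ger0_norm ?divr_ge0 ?(ltW c0) // -sqrtr_sqr.
rewrite ltr_sqrt; last first.
  by rewrite (lt_le_trans _ hn) // exprn_gt0 // ltr_wpDl ?divr_ge0 ?(ltW c0).
apply: lt_le_trans hn; rewrite ltrXn2r ?nnegrE ?addr_ge0 ?divr_ge0 ?(ltW c0) //.
by rewrite ltrDl.
Qed.

(* For large [n], [n ^ (1/4) <= c * sqrt n <= n]. *)
Lemma ln_scale_sqrt_bounds (c : R) : 0 < c -> \forall n \near \oo,
  0 < ln (n%:R : R) /\
  ln (n%:R : R) / 4 <= ln (c * Num.sqrt n%:R) <= ln (n%:R : R).
Proof.
move=> c0; near=> n.
have n2 : 2 <= n%:R :> R by near: n; exact: near_natr_ge.
have n0 : 0 < n%:R :> R by apply: lt_le_trans n2.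
have s0 : 0 < Num.sqrt n%:R :> R by rewrite sqrtr_gt0.
have cs : c < 1 * Num.sqrt n%:R by near: n; exact: near_sqrt_gt.
have cn : c ^- 4 <= n%:R by near: n; exact: near_natr_ge.
have cs0 : 0 < c * Num.sqrt n%:R by rewrite mulr_gt0.
split; first by rewrite ln_gt0 // (lt_le_trans _ n2) // ltr1n.
apply/andP; split.
  (* After exponentiation the claim is [n <= (c * sqrt n)^4 = c^4 * n^2], that is [c^-4 <= n]. *)
  rewrite ler_pdivrMr // mulr_natr -lnXn // ler_ln ?posrE ?exprn_gt0 //.
  rewrite exprMn (exprM (Num.sqrt _) 2 2) sqrtr_natr_sqr expr2 mulrA ler_peMl ?(ltW n0) //.
  by rewrite mulrC -ler_pdivrMr ?exprn_gt0 // mul1r.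
rewrite ler_ln ?posrE // -[leRHS]sqrtr_natr_sqr expr2 ler_wpM2r ?(ltW s0) //.
by rewrite -[leRHS]mul1r ltW.
Unshelve. all: by end_near. Qed.

Lemma inv_sqr_ln_cvg0 : (ln n%:R ^- 2 : R) @[n --> \oo] --> (0 : R).
Proof.
apply/cvgrPdist_le => e e0.
(* For such [n] the logarithm is at least [1 + 1/e], whose square exceeds [1/e]. *)
apply: filterS (near_natr_ge (expR (1 + e^-1))) => n hn.
have n0 : 0 < n%:R :> R by apply: lt_le_trans hn; exact: expR_gt0.
have eL : 1 + e^-1 <= ln n%:R by rewrite -ler_expR lnK.
have e1 : 0 < e^-1 by rewrite invr_gt0.
rewrite sub0r normrN ger0_norm ?invr_ge0 ?sqr_ge0 //.
by rewrite -[leRHS]invrK lef_pV2 ?posrE //; nra.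
Qed.

(** Eventually [h <= 1 / C], hence [g <= 1] and [g / (1 + g) >= g / 2]; this costs the factor 2 in
    the constant. *)
Lemma asymp_between (f g h : nat -> R) :
  asymp \oo g h -> h @ \oo --> (0 : R) -> (forall n, 0 <= h n) ->
  (forall n, g n / (1 + g n) <= f n <= g n) -> asymp \oo f h.
Proof.
move=> [C C0 gh] h0 hge0 fg; exists (2 * C); first by rewrite mulr_gt0.
near=> n.
have /andP[hg gC] : C^-1 * h n <= g n <= C * h n by near: n.
have h1 : h n <= C^-1.
  near: n. 
  have /cvgrPdist_le/(_ C^-1) := h0; rewrite invr_gt0 => /(_ C0).
  by apply: filterS => n; rewrite sub0r normrN ger0_norm.
have g1 : g n <= 1.
  by apply: le_trans gC _; rewrite -[leRHS](mulfV (lt0r_neq0 C0)) ler_wpM2l // ltW.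
have g0 : 0 <= g n by apply: le_trans hg; rewrite mulr_ge0 // invr_ge0 ltW.
have /andP[gf fgn] := fg n.
apply/andP; split; last first.
  apply: le_trans fgn _; apply: le_trans gC _.
  by rewrite -mulrA ler_peMl ?ler1n // mulr_ge0 // ltW.
apply: le_trans gf; rewrite ler_pdivlMr ?ltr_wpDr //.
have u0 : 0 <= C^-1 * h n by rewrite mulr_ge0 // invr_ge0 ltW.
rewrite invfM -[2^-1 * _ * _]mulrA; move: (C^-1 * h n) hg u0 => u ug u0.
nra.
Unshelve. all: by end_near. Qed.

(** The factor [n^2] cancels the fourth power of [sqrt n], and the two logarithms are comparable. *)
Lemma tail_scale_sqrt_asymp (p : R -> R) (c : R) : 0 < c ->
  asymp (pinfty_nbhs R) p (fun t => t ^- 4 * ln t ^- 2) ->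
  asymp \oo (fun n => n%:R ^+ 2 * p (c * Num.sqrt n%:R)) (fun n => ln n%:R ^- 2).
Proof.
move=> c0 [C C0 [M [_ HM]]].
(* One constant for both sides: the lower bound needs [C * c^4], the upper one [16 * C * c^-4], with
   16 from the squared ratio of logarithms. *)
pose D := 16 * (C * (c ^+ 4 + c ^- 4)).
have c4 : 0 < c ^+ 4 by rewrite exprn_gt0.
have c8 : 0 < c ^+ 4 + c ^- 4 by rewrite addr_gt0 // invr_gt0.
have D0 : 0 < D by rewrite !mulr_gt0.
exists D => //; near=> n.
have Mn : M < c * Num.sqrt n%:R by near: n; exact: near_sqrt_gt.
have [L0 /andP[l1 l2]] : 0 < ln (n%:R : R) /\
  ln (n%:R : R) / 4 <= ln (c * Num.sqrt n%:R) <= ln (n%:R : R).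
  by near: n; exact: ln_scale_sqrt_bounds.
have n0 : 0 < n%:R :> R.
  by apply: lt_le_trans (_ : 1 <= _) => //; near: n; exact: near_natr_ge.
have /andP[pl pu] := HM _ Mn.
have n20 : 0 < n%:R ^+ 2 :> R by rewrite exprn_gt0.
have st : (c * Num.sqrt n%:R) ^- 4 = c ^- 4 * (n%:R ^+ 2)^-1.
  by rewrite exprMn (exprM (Num.sqrt _) 2 2) sqrtr_natr_sqr invfM.
rewrite st in pl pu.
set l := ln (c * Num.sqrt n%:R) in l1 l2 pl pu.
set L := ln n%:R in L0 l1 l2 *.
have l0 : 0 < l by apply: lt_le_trans l1; rewrite divr_gt0.
have lL : L ^- 2 <= l ^- 2 <= 16 * L ^- 2.
  apply/andP; split.
    by rewrite lef_pV2 ?posrE ?exprn_gt0 // lerXn2r ?nnegrE // ltW.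
  have -> : 16 * L ^- 2 = (L / 4) ^- 2 by field; rewrite gt_eqF.
  by rewrite lef_pV2 ?posrE ?exprn_gt0 ?divr_gt0 // lerXn2r ?nnegrE ?divr_ge0 // ltW.
have /andP[lL1 lL2] := lL.
have Lm0 : 0 < L ^- 2 by rewrite invr_gt0 exprn_gt0.
have lm0 : 0 < l ^- 2 by rewrite invr_gt0 exprn_gt0.
apply/andP; split.
  apply: le_trans (ler_wpM2l (ltW n20) pl).
  have -> : n%:R ^+ 2 * (C^-1 * (c ^- 4 / n%:R ^+ 2 * l ^- 2)) = (C * c ^+ 4)^-1 * l ^- 2.
    by rewrite invfM; move: (l ^- 2) => u; field; rewrite !gt_eqF.
  apply: ler_pM; rewrite ?invr_ge0 ?(ltW D0) ?sqr_ge0 //.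
  rewrite lef_pV2 ?posrE ?mulr_gt0 // /D.
  apply: (@le_trans _ _ (1 * (C * (c ^+ 4 + c ^- 4)))).
    by rewrite mul1r ler_wpM2l ?(ltW C0) // lerDl invr_ge0 ltW.
  by rewrite ler_wpM2r ?ler1n // mulr_ge0 ?(ltW C0) ?(ltW c8).
apply: le_trans (ler_wpM2l (ltW n20) pu) _.
have -> : n%:R ^+ 2 * (C * (c ^- 4 / n%:R ^+ 2 * l ^- 2)) = (C * c ^- 4) * l ^- 2.
  by move: (l ^- 2) (c ^- 4) => u v; field; rewrite !gt_eqF.
apply: le_trans (ler_wpM2l _ lL2) _.
  by rewrite mulr_ge0 ?invr_ge0 ?(ltW C0) ?(ltW c4).
rewrite mulrCA !mulrA -!(mulrA 16) /D ler_wpM2l // ler_wpM2r ?(ltW Lm0) //.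
by rewrite ler_wpM2l ?(ltW C0) // lerDr ltW.
Unshelve. all: by end_near. Qed.

(** Comparison with the harmonic series: a finite sum [S] would bound the harmonic partial sums from
    [N + 1] on by [4 * C * S]. *)
Lemma nneseries_inv_sqr_ln_pinfty (u : nat -> R) :
  (forall n, 0 <= u n) -> asymp \oo u (fun n => ln n%:R ^- 2) ->
  (\sum_(0 <= n <oo) (u n)%:E = +oo)%E.
Proof.
move=> u0 [C C0 [N _ HN]]; apply: contrapT => /eqP; rewrite -ltey => sumu.
have sumfin : (\sum_(0 <= n <oo) (u n)%:E)%E \is a fin_num.
  by rewrite ge0_fin_numE // nneseries_ge0 // => n _ _; rewrite lee_fin.
pose S := fine (\sum_(0 <= n <oo) (u n)%:E)%E.
have partial m n : \sum_(m <= k < n) u k <= S.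
  have [nm|/ltnW mn] := leqP n m.
    by rewrite big_geq // fine_ge0 // nneseries_ge0 // => k _ _; rewrite lee_fin.
  apply: (@le_trans _ _ (\sum_(0 <= k < n) u k)).
    by rewrite (big_cat_nat (leq0n m) mn) /= lerDr sumr_ge0.
  rewrite -lee_fin fineK // -sumEFin.
  by apply: (nneseries_lim_ge (P := xpredT)) => k _ _; rewrite lee_fin.
apply: (@dvg_harmonic R); rewrite -(is_cvg_series_restrict N.+1).
apply: nondecreasing_is_cvgn.
  move=> m n mn /=; have [mN|/ltnW Nm] := leqP m N.+1.
    by rewrite big_geq // sumr_ge0 // => k _; rewrite invr_ge0.
  by rewrite (big_cat_nat Nm mn) /= lerDl sumr_ge0 // => k _; rewrite invr_ge0.
exists (4 * C * S) => _ [n _ <-] /=.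
(* The harmonic term of index [k] is [1 / (k + 1)], hence the shift to [u k.+1]. *)
apply: (@le_trans _ _ (4 * C * \sum_(N.+1 <= k < n) u k.+1)); last first.
  rewrite ler_wpM2l ?mulr_ge0 ?(ltW C0) //.
  have := partial N.+2 n.+1; by rewrite big_add1.
rewrite mulr_sumr; apply: ler_sum_nat => k /andP[Nk _].
have /andP[uk _] := HN k.+1 (leq_trans (ltnW Nk) (leqnSn k)).
have k0 : 0 < k.+1%:R :> R by [].
have L0 : 0 < ln k.+1%:R :> R by rewrite ln_gt0 // ltr1n ltnS (leq_ltn_trans _ Nk).
(* The logarithm is twice that of the square root, and [ln s < s]. *)
have L4 : ln k.+1%:R ^+ 2 <= 4 * k.+1%:R :> R.
  have s0 : 0 < Num.sqrt k.+1%:R :> R by rewrite sqrtr_gt0.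
  rewrite -sqrtr_natr_sqr lnXn // mulr2n.
  have := ln_sublinear s0.
  have : 0 < ln (Num.sqrt k.+1%:R) *+ 2 :> R by rewrite -lnXn // sqrtr_natr_sqr.
  rewrite mulr2n.
  nra.
rewrite -mulrA -ler_pdivrMl // -ler_pdivrMl //.
apply: le_trans uk; rewrite ler_wpM2l ?invr_ge0 ?(ltW C0) //.
by rewrite -invfM lef_pV2 ?posrE ?exprn_gt0 ?mulr_gt0.
Qed.

End Asymptotics.

(** * Passage to limits and the conclusion *)

Lemma asymp_cvg0 (R : realType) (f h : nat -> R) : (forall n, 0 <= f n) ->
  asymp \oo f h -> h @ \oo --> (0 : R) -> f @ \oo --> (0 : R).
Proof.
move=> f0 [C _ fh] h0; apply: (@squeeze_cvgr _ _ _ _ (fun=> 0) (fun n => C * h n)).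
- by apply: filterS fh => n /andP[_ fC]; rewrite f0.
- exact: cvg_cst.
- by have := cvgM (cvg_cst C) h0; rewrite mulr0; exact.
Qed.

Lemma cvg_not_infinitely_often_gt (R : realType) (u : nat -> R) (l c : R) :
  u @ \oo --> l -> l < c -> ~ (forall N, exists2 n, (N <= n)%N & c < u n).
Proof.
move=> ul lc io.
have [N _ HN] : \forall n \near \oo, u n < c by apply: (cvgr_lt l).
by have [n Nn] := io N; rewrite ltNge ltW // HN.
Qed.

(** Supplies a sample point at which two incompatible almost sure statements can be confronted. *)
Lemma ae_exists (R : realType) (d : measure_display) (T : measurableType d)
    (P : probability T R) (Q : T -> Prop) : {ae P, forall w, Q w} -> exists w, Q w.
Proof.
move=> [N [mN N0 QN]]; apply: contrapT => /forallNP noQ.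
have : P setT = 0%E by apply: (subset_measure0 _ _ _ N0) => // w _; exact: QN (noQ w).
by rewrite probability_setT => /eqP; rewrite onee_eq0.
Qed.

Theorem mainTheorem4 (R : realType)
  (d0 : measure_display) (T0 : measurableType d0) (P0 : probability T0 R)
  (xi : {RV P0 >-> R})
  (xi_symmetric : symmetric_law xi)
  (xi_tail : asymp (pinfty_nbhs R)
     (fun t => fine (P0 [set w | t < `|xi w|])) (fun t => t ^- 4 * ln t ^- 2))
  (d : measure_display) (T : measurableType d) (P : probability T R)
  (Xi : forall n : nat, 'I_n -> 'I_n -> {RV P >-> R})
  (Xi_iid : forall n, iid_entries xi (Xi n))
  (Xi_independent : mutually_independent P (fun n => sigma_mx (Xi n))) :
  [/\ ('E_P0[xi] = 0)%E /\ ('E_P0[fun w => (`|xi w| ^+ 4)%R] < +oo)%E,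
      forall c : R, 0 < c ->
        let E n := [set w | c * Num.sqrt n%:R < max_entry (Xi n) w] in
        [/\ asymp \oo (fun n => fine (P (E n))) (fun n => ln n%:R ^- 2),
            P (E n) @[n --> \oo] --> 0%E,
            (\sum_(0 <= n <oo) P (E n) = +oo)%E &
            {ae P, forall w, forall N : nat, exists n,
               [/\ (N <= n)%N, E n w & c < opnorm (scaled_mx (Xi n) w)]}],
      ~ {ae P, forall w, opnorm (scaled_mx (Xi n) w) @[n --> \oo] -->
           2 * Num.sqrt (fine 'E_P0[fun w0 => (xi w0 ^+ 2)%R])} &
      ~ strong_convergence_for_every_coupling R].
Proof.
have [C C0 tailC] := xi_tail.
have m4 : ('E_P0[fun w => (`|xi w| ^+ 4)%R] < +oo)%E.
  apply: (fourth_moment_finite (ltW C0)).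
  by apply: filterS tailC => t /andP[].
have part2 (c : R) : 0 < c ->
    let E n := [set w | c * Num.sqrt n%:R < max_entry (Xi n) w] in
    [/\ asymp \oo (fun n => fine (P (E n))) (fun n => ln n%:R ^- 2),
        P (E n) @[n --> \oo] --> 0%E,
        (\sum_(0 <= n <oo) P (E n) = +oo)%E &
        {ae P, forall w, forall N : nat, exists n,
           [/\ (N <= n)%N, E n w & c < opnorm (scaled_mx (Xi n) w)]}].
  move=> c0 E.
  have t0 n : 0 <= c * Num.sqrt n%:R by rewrite mulr_ge0 ?sqrtr_ge0 // ltW.
  have mE n : measurable (E n) by exact: measurable_max_entry_gt.
  have PEfin n : P (E n) \is a fin_num by rewrite fin_num_measure.
  have asE : asymp \oo (fun n => fine (P (E n))) (fun n => ln n%:R ^- 2).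
    apply: asymp_between (tail_scale_sqrt_asymp c0 xi_tail)
      (@inv_sqr_ln_cvg0 R) _ _ => n; first by rewrite invr_ge0 sqr_ge0.
    exact: (max_entry_tail (Xi_iid n)).
  have sumE : (\sum_(0 <= n <oo) P (E n) = +oo)%E.
    rewrite -[RHS](nneseries_inv_sqr_ln_pinfty _ asE) => [|n]; last by rewrite fine_ge0.
    by apply: eq_eseriesr => n _; rewrite fineK.
  split=> //.
    apply/fine_cvgP; split; first exact: nearW.
    apply: asymp_cvg0 asE (@inv_sqr_ln_cvg0 R) => n.
    by rewrite fine_ge0.
  have ioE := borel_cantelli2 Xi_independent mE
    (fun n => sigma_mx_max_entry (X := Xi n) (t0 n)) sumE.
  apply: filterS ioE => w ioE N; have [n Nn En] := ioE N; exists n; split=> //.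
  exact: (max_entry_lt_opnorm (ltW c0)).
(* An arbitrary deterministic limit is refuted, to serve both for the edge value and for the norm in
   a strong convergence theorem. *)
have not_cvg (l : R) :
    ~ {ae P, forall w, opnorm (scaled_mx (Xi n) w) @[n --> \oo] --> l}.
  move=> cvgl.
  have c0 : 0 < `|l| + 1 by rewrite ltr_wpDl.
  have [_ _ _ io] := part2 _ c0.
  have [w [lw iow]] := ae_exists (filterI cvgl io).
  apply: (cvg_not_infinitely_often_gt lw (c := `|l| + 1)).
    by rewrite (le_lt_trans (ler_norm l)) // ltrDl.
  by move=> N; have [n [Nn _ cn]] := iow N; exists n.
split=> //.
  by split=> //; exact: symmetric_mean0 xi_symmetric m4.
move=> strong.
have [A [x [_ cvgx]]] := strong _ _ _ _ xi_symmetric m4 _ _ _ _ Xi_iid.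
(* For the polynomial [SVar], strong convergence is convergence of the operator norm itself. *)
apply: (not_cvg (cnorm x)); apply: filterS cvgx => w /(_ (SVar R)).
exact.
Qed.
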